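(* Let $\Omega$ and $\Delta$ be locally compact Hausdorff spaces. Suppose that $E$ is a full Hilbert $C_0(\Omega)$-module and $F$ is a full Hilbert $C_0(\Delta)$-module. If $\theta : E\to F$ is a bijective $\mathbb{C}$-linear map (not assumed to be bounded) such that both $\theta$ and $\theta^{-1}$ are quasi-local and orthogonality preserving, then $\theta$ is bounded and $$\theta(e)(\nu) = \psi(\nu)J_\nu(e(\sigma(\nu))), \quad \forall e\in E,\ \forall \nu\in \Delta,$$ where $\sigma:\Delta \to \Omega$ is a homeomorphism, $\psi$ is a strictly positive element in $C_b(\Delta)_+$, and, for each $\nu\in\Delta$, $J_\nu$ is a unitary operator from $\Xi^E_{\sigma(\nu)}$ onto $\Xi^F_\nu$ such that for each fixed $f\in E$ the map $\nu \mapsto J_\nu(f(\sigma(\nu)))$ is continuous.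
   Context: $C_0(\Omega)$ is the $C^*$-algebra of continuous complex-valued functions on $\Omega$ vanishing at infinity. Hilbert $C_0(\Omega)$-modules are right Hilbert $C^*$-modules with $C_0(\Omega)$-valued inner product $\langle\cdot,\cdot\rangle$ satisfying $\langle x,ya\rangle=\langle x,y\rangle a$ and $\langle x,y\rangle^*=\langle y,x\rangle$, complete in the norm $\|x\|=\|\langle x,x\rangle\|^{1/2}$. Such a module $E$ is full if the $\mathbb{C}$-linear span of $\{\langle e,f\rangle:e,f\in E\}$ is dense in $C_0(\Omega)$. For $\omega\in\Omega$, let $K^E_\omega=\{e\in E:\langle e,e\rangle(\omega)=0\}$. The fibre of $E$ at $\omega$ is the Hilbert space $\Xi^E_\omega=E/K^E_\omega$, with inner product induced by $(e,f)\mapsto\langle e,f\rangle(\omega)$; write $e(\omega)=e+K^E_\omega\in\Xi^E_\omega$. Put $\operatorname{supp}_\Omega e=\overline{\{\omega\in\Omega:e(\omega)\neq0\}}$ (closure in $\Omega$). The same notation is used for Hilbert $C_0(\Delta)$-modules, with $\Delta$ in place of $\Omega$. A map $\theta:E\to F$ is orthogonality preserving if $\langle\theta(x),\theta(y)\rangle=0$ whenever $x,y\in E$ and $\langle x,y\rangle=0$ (similarly for $\theta^{-1}:F\to E$). A $\mathbb{C}$-linear map $\theta:E\to F$ from a Hilbert $C_0(\Omega)$-module to a Hilbert $C_0(\Delta)$-module is quasi-local if it is bijective and $\operatorname{supp}_\Omega\theta^{-1}(\theta(e)\lambda)\subseteq\operatorname{supp}_\Omega e$ for all $e\in E$ and $\lambda\in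 C_0(\Delta)$. Accordingly, $\theta^{-1}:F\to E$ is quasi-local if $\operatorname{supp}_\Delta\theta(\theta^{-1}(f)\lambda)\subseteq\operatorname{supp}_\Delta f$ for all $f\in F$ and $\lambda\in C_0(\Omega)$. $C_b(\Delta)_+$ is the set of bounded continuous non-negative real functions on $\Delta$; strictly positive means $>0$ at every point. Continuity of a section $s:\nu\mapsto s(\nu)\in\Xi^F_\nu$ refers to the Hilbert bundle $\Xi^F$ over $\Delta$ associated with $F$: $s$ is continuous if for every $\nu_0\in\Delta$ and $\varepsilon>0$ there are $f\in F$ and a neighborhood $W$ of $\nu_0$ with $\|s(\nu)-f(\nu)\|<\varepsilon$ for all $\nu\in W$. *)

(* Defs.v *)
From HB Require Import structures.
From mathcomp Require Import all_boot all_order all_algebra.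
From mathcomp Require Import generic_quotient ring_quotient complex.
From mathcomp Require Import boolp classical_sets functions reals topology.
From mathcomp Require Import normedtype ring.

Set Implicit Arguments.
Unset Strict Implicit.
Unset Printing Implicit Defensive.

Import Order.TTheory GRing.Theory Num.Theory numFieldNormedType.Exports.
Import ComplexField.Normc.

Local Open Scope classical_set_scope.
Local Open Scope ring_scope.
Local Open Scope quotient_scope.

(* The libraries put no topology on [complex]; use the one of its modulus. *)
HB.instance Definition _ (R : realType) := NormedModule.copy R[i] R[i]^o.

Section C0Predicate.
Context {R : realType} {X : topologicalType}.
Implicit Types f g : X -> R[i].

Definition vanishes_at_infinity f := forall eps : R[i], 0 < eps ->
  exists2 K : set X, compact K & forall x, ~ K x -> `|f x| < eps.

Definition c0_pred : {pred X -> R[i]} :=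
  fun f => `[< continuous f /\ vanishes_at_infinity f >].

Lemma c0_predP f :
  reflect (continuous f /\ vanishes_at_infinity f) (f \in c0_pred).
Proof. exact: asboolP. Qed.

Lemma c0_pred_bounded f : f \in c0_pred ->
  exists M : R, forall x, normc (f x) <= M.
Proof.
move=> /c0_predP[cf /(_ 1 ltr01)[K /compact_near_coveringP cK fK]].
have [|M [_ MK]] := cK R +oo (fun M x => normc (f x) <= M) _.
  move=> x _; have : \forall y \near x, normc (f y) <= normc (f x) + 1.
    have /cvgrPdist_lt/(_ 1 ltr01) := cf x.
    apply: filterS => y fxy; rewrite -lecR rmorphD rmorph1.
    suff : `|f y| <= `|f x| + 1 by [].
    rewrite -lerBlDl (le_trans (lerB_dist _ _))// distrC; exact: ltW.
  move=> fx; near=> y M => /=; apply: (@le_trans _ _ (normc (f x) + 1)).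
    by near: y; exact: fx.
  by near: M; apply: nbhs_pinfty_ge; rewrite num_real.
exists (Num.max (M + 1) 1) => x; have [Kx|nKx] := pselect (K x).
  by rewrite le_max (MK (M + 1))// ltrDl.
by rewrite le_max -[X in _ || X]lecR [X in _ || X]ltW ?orbT//; exact: fK.
Unshelve. all: by end_near. Qed.

Lemma c0_pred_submod_closed : submod_closed c0_pred.
Proof.
split=> [|a f g /c0_predP[cf vf] /c0_predP[cg vg]]; apply/c0_predP; split.
- by move=> x; exact: cvg_cst.
- by move=> e e0; exists set0 => [|x _]; [exact: compact0|rewrite normr0].
- by move=> x; apply: cvgD; [apply: cvgZr; exact: cf|exact: cg].
- move=> e e0; have a0 : 0 < `|a| + 1 by rewrite ltr_wpDl.
  have [K cK fK] := vf (e / 2 / (`|a| + 1)) ltac:(by rewrite !divr_gt0).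
  have [L cL gL] := vg (e / 2) ltac:(by rewrite divr_gt0).
  exists (K `|` L) => [|x /not_orP[/fK fx /gL gx]]; first exact: compactU.
  rewrite (le_lt_trans (ler_normD _ _))// [ltRHS]splitr ler_ltD// normrZ.
  rewrite (@le_trans _ _ ((`|a| + 1) * `|f x|))//.
    by rewrite ler_wpM2r// lerDl.
  by rewrite mulrC -ler_pdivlMr// ltW.
Qed.

HB.instance Definition _ :=
  GRing.isSubmodClosed.Build R[i] (X -> R[i]) c0_pred c0_pred_submod_closed.

Lemma c0_predM f g : f \in c0_pred -> g \in c0_pred ->
  (fun x => f x * g x) \in c0_pred.
Proof.
move=> f0 /c0_predP[cg vg]; have /c0_predP[cf _] := f0.
apply/c0_predP; split=> [x|e e0]; first by apply: cvgM; [exact: cf|exact: cg].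
have [M fM] := c0_pred_bounded f0.
have M0 : 0 < `|M%:C%C| + 1 by rewrite ltr_wpDl.
have [K cK gK] := vg (e / (`|M%:C%C| + 1)) ltac:(by rewrite divr_gt0).
exists K => // x /gK gx; rewrite normrM -(divfK (lt0r_neq0 M0) e) mulrC.
rewrite (@le_lt_trans _ _ (`|g x| * (`|M%:C%C| + 1)))//; last by rewrite ltr_pM2r.
rewrite ler_wpM2l// (@le_trans _ _ M%:C%C)//; first by rewrite lecR.
by rewrite (le_trans (real_ler_norm _)) ?lerDl// complex_real.
Qed.

Lemma c0_predJ f : f \in c0_pred -> (fun x => (f x)^*) \in c0_pred.
Proof.
move=> /c0_predP[cf vf]; apply/c0_predP; split=> [x|e e0].
  apply/cvgrPdist_lt => e e0; have /cvgrPdist_lt/(_ e e0) := cf x.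
  by apply: filterS => y; rewrite -rmorphB norm_conjC.
have [K cK fK] := vf e e0; exists K => // x /fK.
by rewrite norm_conjC.
Qed.

End C0Predicate.

Section C0Type.
Variables (R : realType) (X : topologicalType).

Record C0 := MkC0 { c0_fun :> X -> R[i]; c0_funP : c0_fun \in c0_pred }.

HB.instance Definition _ := [isSub for c0_fun].
HB.instance Definition _ := [Choice of C0 by <:].
HB.instance Definition _ := [SubChoice_isSubLmodule of C0 by <:].

Implicit Types f g : C0.

Lemma c0P f g : (forall x, f x = g x) -> f = g.
Proof. by move=> fg; apply/val_inj/funext. Qed.

Lemma c0DE f g x : (f + g) x = f x + g x. Proof. by []. Qed.
Lemma c0ZE a f x : (a *: f) x = a * f x. Proof. by []. Qed.

Definition c0_mul f g : C0 := MkC0 (c0_predM (c0_funP f) (c0_funP g)).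
Definition c0_conj f : C0 := MkC0 (c0_predJ (c0_funP f)).

Definition c0_norm f : R[i] := (sup (range (fun x => normc (f x))))%:C%C.

Lemma c0_has_ubound f : has_ubound (range (fun x => normc (f x))).
Proof.
have [M fM] := c0_pred_bounded (c0_funP f).
by exists M => _ [x _ <-].
Qed.

Lemma ler_c0_norm f x : `|f x| <= c0_norm f.
Proof.
rewrite -[`|f x|]/((normc (f x))%:C%C) lecR.
by apply: (ub_le_sup (c0_has_ubound f)); exists x.
Qed.

Lemma c0_norm_le f (M : R) : 0 <= M ->
  (forall x, `|f x| <= M%:C%C) -> c0_norm f <= M%:C%C.
Proof.
move=> M0 fM; rewrite lecR; have [->|/set0P ne] := eqVneq (range (fun x => normc (f x))) set0.
  by rewrite sup0.
by apply: ge_sup => // _ [x _ <-]; rewrite -lecR; exact: fM.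
Qed.

Lemma c0_norm_ge0 f : 0 <= sup (range (fun x => normc (f x))).
Proof.
have [->|/set0P [_ [x _ _]]] := eqVneq (range (fun x => normc (f x))) set0.
  by rewrite sup0.
by rewrite -lecR (le_trans _ (ler_c0_norm f x))// (normr_ge0 (f x)).
Qed.

Lemma c0_normD f g : c0_norm (f + g) <= c0_norm f + c0_norm g.
Proof.
rewrite -rmorphD; apply: c0_norm_le => [|x]; first by rewrite addr_ge0 ?c0_norm_ge0.
by rewrite rmorphD (le_trans (ler_normD _ _))// lerD// ler_c0_norm.
Qed.

Lemma c0_normZ_le a f : c0_norm (a *: f) <= `|a| * c0_norm f.
Proof.
rewrite -[`|a|]/((normc a)%:C%C) -rmorphM; apply: c0_norm_le => [|x].
  by rewrite mulr_ge0 ?c0_norm_ge0// -lecR (normr_ge0 a).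
by rewrite rmorphM/= normrM ler_wpM2l ?ler_c0_norm// (normr_ge0 a).
Qed.

Lemma c0_normZ a f : c0_norm (a *: f) = `|a| * c0_norm f.
Proof.
apply/eqP; rewrite eq_le c0_normZ_le/=.
have [->|a0] := eqVneq a 0.
  by rewrite normr0 mul0r lecR c0_norm_ge0.
rewrite -ler_pdivlMl ?normr_gt0// -normfV.
by rewrite (le_trans _ (c0_normZ_le _ _))// scalerA mulVf// scale1r.
Qed.

Lemma c0_norm0_eq0 f : c0_norm f = 0 -> f = 0.
Proof.
move=> f0; apply: c0P => x; apply/eqP; rewrite -normr_le0 -f0.
exact: ler_c0_norm.
Qed.

HB.instance Definition _ :=
  Lmodule_isNormed.Build R[i] C0 c0_normD c0_normZ c0_norm0_eq0.

End C0Type.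

HB.mixin Record isHilbertC0Module (R : realType) (X : topologicalType) E
    of CompleteNormedModule R[i] E := {
  ract : E -> C0 R X -> E;
  inner : E -> E -> C0 R X;
  ractDl : forall x y a, ract (x + y) a = ract x a + ract y a;
  ractDr : forall x a b, ract x (a + b) = ract x a + ract x b;
  ractM : forall x a b, ract x (c0_mul a b) = ract (ract x a) b;
  ractZl : forall c x a, ract (c *: x) a = c *: ract x a;
  ractZr : forall c x a, ract x (c *: a) = c *: ract x a;
  innerDr : forall x y z, inner x (y + z) = inner x y + inner x z;
  innerZr : forall c x y, inner x (c *: y) = c *: inner x y;
  inner_ract : forall x y a, inner x (ract y a) = c0_mul (inner x y) a;
  inner_conj : forall x y, c0_conj (inner x y) = inner y x;
  inner_ge0 : forall x w, 0 <= inner x x w;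
  inner_eq0 : forall x, inner x x = 0 -> x = 0;
  hilbert_normE : forall x, `|x| = sqrtC `|inner x x|
}.

#[short(type="hilbertC0Module")]
HB.structure Definition HilbertC0Module (R : realType) (X : topologicalType) :=
  {E of CompleteNormedModule R[i] E & isHilbertC0Module R X E}.

Section Fullness.
Variables (R : realType) (X : topologicalType) (E : hilbertC0Module R X).

Definition inner_span : set (C0 R X) :=
  [set h | exists n (c : 'I_n -> R[i]) (e f : 'I_n -> E),
     h = \sum_(i < n) c i *: inner (e i) (f i)].

Definition full_module := dense inner_span.

End Fullness.

Section Fibre.
Variables (R : realType) (X : topologicalType) (E : hilbertC0Module R X).
Variable w : X.
Implicit Types x y z : E.

Let ip x y : R[i] := inner x y w.

Let ipDr x y z : ip x (y + z) = ip x y + ip x z.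
Proof. by rewrite /ip innerDr. Qed.
Let ipZr c x y : ip x (c *: y) = c * ip x y.
Proof. by rewrite /ip innerZr. Qed.
Let ipC x y : ip y x = (ip x y)^*.
Proof. by rewrite /ip -inner_conj. Qed.
Let ip_ge0 x : 0 <= ip x x. Proof. exact: inner_ge0. Qed.
Let ipDl x y z : ip (x + y) z = ip x z + ip y z.
Proof. by rewrite ipC ipDr rmorphD/= -!ipC. Qed.
Let ipZl c x y : ip (c *: x) y = c^* * ip x y.
Proof. by rewrite ipC ipZr rmorphM/= -ipC. Qed.

Let ip_expand x y c : c \is Num.real ->
  ip (x - (c * (ip x y)^*) *: y) (x - (c * (ip x y)^*) *: y)
    = ip x x - c * `|ip x y| ^+ 2 *+ 2 + c ^+ 2 * `|ip x y| ^+ 2 * ip y y.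
Proof.
move=> cR; rewrite -scaleNr ipDr !ipDl !ipZr !ipZl (ipC x y) normCK.
by rewrite rmorphN rmorphM/= conjCK (CrealP cR); ring.
Qed.

Let ip_cs x y : `|ip x y| ^+ 2 <= ip x x * ip y y.
Proof.
wlog yy0 : x y / ip y y != 0 => [cs|].
  have [yy0|] := eqVneq (ip y y) 0; last exact: cs.
  have [xx0|] := eqVneq (ip x x) 0; last first.
    by move=> /(cs y x); rewrite mulrC ipC norm_conjC.
  have := ip_ge0 (x - (1 * (ip x y)^*) *: y).
  rewrite ip_expand// xx0 yy0 !mulr0 addr0 add0r mul1r oppr_ge0.
  by rewrite pmulrn_lle0.
have y0 : 0 < ip y y by rewrite lt_def yy0 ip_ge0.
have := ip_ge0 (x - ((ip y y)^-1 * (ip x y)^*) *: y).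
rewrite ip_expand ?rpredV ?ger0_real//.
have -> : (ip y y)^-1 ^+ 2 * `|ip x y| ^+ 2 * ip y y
    = (ip y y)^-1 * `|ip x y| ^+ 2.
  by field.
rewrite mulr2n opprD addrA subrK subr_ge0 mulrC ler_pdivrMr//.
Qed.

(* [fibre_null] is $K_w$, so that [fibre] below is $E / K_w$. *)
Definition fibre_null : {pred E} := fun e => inner e e w == 0.

Lemma inner_null x y : x \in fibre_null -> inner x y w = 0.
Proof.
move=> /eqP x0; apply/eqP; rewrite -normr_eq0 -sqrf_eq0 eq_le exprn_ge0// andbT.
by rewrite (le_trans (ip_cs x y))// /ip x0 mul0r.
Qed.

Lemma fibre_null_submod_closed : submod_closed fibre_null.
Proof.
split=> [|c x y x0 y0]; apply/eqP; rewrite -/(ip _ _).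
  by rewrite -[X in ip _ X](scale0r 0) ipZr mul0r.
by rewrite ipDl ipZl [ip x _]inner_null// [ip y _]inner_null// mulr0 addr0.
Qed.

HB.instance Definition _ :=
  GRing.isSubmodClosed.Build R[i] E fibre_null fibre_null_submod_closed.

Definition fibre := Quotient.quot (fibre_null : zmodClosed E).

HB.instance Definition _ := Choice.on fibre.
HB.instance Definition _ := GRing.Zmodule.on fibre.

(* The value $e(w) = e + K_w$ of [e] at [w]. *)
Definition value (e : E) : fibre := \pi_fibre e.

Lemma value_ind (P : fibre -> Prop) : (forall e, P (value e)) -> forall u, P u.
Proof. by move=> Pe u; rewrite -[u]reprK; exact: Pe. Qed.

Lemma value_eq x y : (value x = value y) <-> (x - y \in fibre_null).
Proof.
by rewrite Quotient.idealrBE; split=> /eqP.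
Qed.

Lemma valueD x y : value (x + y) = value x + value y.
Proof. exact: (Quotient.pi_add (fibre_null : zmodClosed E)). Qed.

Lemma null_repr x : x - repr (value x) \in fibre_null.
Proof. by apply/value_eq; rewrite /value reprK. Qed.

Definition fibre_scale (c : R[i]) (u : fibre) : fibre := value (c *: repr u).

Lemma fibre_scaleE c x : fibre_scale c (value x) = value (c *: x).
Proof.
by apply/value_eq; rewrite -scalerBr rpredZ// -opprB rpredN null_repr.
Qed.

Let scaleA a b u : fibre_scale a (fibre_scale b u) = fibre_scale (a * b) u.
Proof.
by elim/value_ind: u => x; rewrite !fibre_scaleE scalerA.
Qed.
Let scale1 : left_id 1 fibre_scale.
Proof. by elim/value_ind => x; rewrite fibre_scaleE scale1r. Qed.
Let scaleDr : right_distributive fibre_scale +%R.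
Proof.
move=> a; elim/value_ind => x; elim/value_ind => y.
by rewrite -valueD !fibre_scaleE scalerDr valueD.
Qed.
Let scaleDl u : {morph fibre_scale^~ u : a b / a + b}.
Proof.
by move=> a b; elim/value_ind: u => x; rewrite !fibre_scaleE scalerDl valueD.
Qed.

HB.instance Definition _ :=
  GRing.Zmodule_isLmodule.Build R[i] fibre scaleA scale1 scaleDr scaleDl.

Lemma valueZ c x : value (c *: x) = c *: value x.
Proof. by rewrite -fibre_scaleE. Qed.

Definition fibre_inner (u v : fibre) : R[i] := inner (repr u) (repr v) w.

Lemma fibre_innerE x y : fibre_inner (value x) (value y) = inner x y w.
Proof.
rewrite /fibre_inner; set x' := repr _; set y' := repr _.
have xE : x = x' + (x - x') by rewrite addrC subrK.
have yE : y = y' + (y - y') by rewrite addrC subrK.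
rewrite xE -!/(ip _ _) ipDl [ip (x - x') _]inner_null ?null_repr// addr0.
rewrite yE ipDr [ip _ (y - y')]ipC [ip (y - y') _]inner_null ?null_repr//.
by rewrite conjC0 addr0.
Qed.

Definition fibre_norm (u : fibre) : R[i] := sqrtC (fibre_inner u u).

Let fnormE x : fibre_norm (value x) = sqrtC (ip x x).
Proof. by rewrite /fibre_norm fibre_innerE. Qed.

Let fibre_normD u v : fibre_norm (u + v) <= fibre_norm u + fibre_norm v.
Proof.
elim/value_ind: u => x; elim/value_ind: v => y; rewrite -valueD !fnormE.
have cs : `|ip x y| <= sqrtC (ip x x) * sqrtC (ip y y).
  rewrite -(@ler_pXn2r _ 2)// ?nnegrE ?mulr_ge0 ?sqrtC_ge0//.
  by rewrite exprMn !sqrtCK ip_cs.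
have re : ip x y + ip y x <= `|ip x y| *+ 2.
  have zR : ip x y + ip y x \is Num.real.
    by apply/CrealP; rewrite rmorphD/= -!ipC addrC.
  rewrite (le_trans (real_ler_norm zR))// (le_trans (ler_normD _ _))//.
  by rewrite [ip y x]ipC norm_conjC mulr2n.
rewrite -(@ler_pXn2r _ 2)// ?nnegrE ?addr_ge0 ?sqrtC_ge0//.
rewrite sqrrD !sqrtCK ipDr !ipDl.
have -> : ip x x + ip y x + (ip x y + ip y y)
    = ip x x + (ip x y + ip y x) + ip y y by ring.
by rewrite lerD2r lerD2l (le_trans re)// lerMn2r cs.
Qed.

Let fibre_normZ c u : fibre_norm (c *: u) = `|c| * fibre_norm u.
Proof.
elim/value_ind: u => x; rewrite -valueZ !fnormE ipZl ipZr mulrA -normCKC.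
by rewrite sqrtCM ?nnegrE ?exprn_ge0// sqrCK.
Qed.

Let fibre_norm_eq0 u : fibre_norm u = 0 -> u = 0.
Proof.
elim/value_ind: u => x; rewrite fnormE => /eqP; rewrite sqrtC_eq0 => x0.
have -> : 0 = value 0 :> fibre by rewrite -[X in value X](scale0r 0) valueZ scale0r.
by apply/value_eq; rewrite subr0.
Qed.

(* Completeness of the fibres is a theorem, and is not recorded here. *)
HB.instance Definition _ :=
  Lmodule_isNormed.Build R[i] fibre fibre_normD fibre_normZ fibre_norm_eq0.

End Fibre.

Section Maps.
Variables (R : realType) (X Y : topologicalType).
Variables (E : hilbertC0Module R X) (F : hilbertC0Module R Y).

Definition orthogonality_preserving (theta : E -> F) :=
  forall x y : E, inner x y = 0 -> inner (theta x) (theta y) = 0.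

Definition bounded_operator (theta : E -> F) :=
  exists M : R, forall e : E, `|theta e| <= M%:C%C * `|e|.

Definition unitary (w : X) (nu : Y) (U : fibre E w -> fibre F nu) :=
  [/\ linear U,
      (forall v, exists u, U u = v) &
      forall u v, fibre_inner (U u) (U v) = fibre_inner u v].

End Maps.

Definition supp (R : realType) (X : topologicalType)
    (E : hilbertC0Module R X) (e : E) : set X :=
  closure [set w | value w e != 0].

Definition quasi_local (R : realType) (X Y : topologicalType)
    (E : hilbertC0Module R X) (F : hilbertC0Module R Y) (theta : E -> F) :=
  linear theta /\
  exists thetai : F -> E, [/\ cancel theta thetai, cancel thetai theta &
    forall (e : E) (lambda : C0 R Y),
      supp (thetai (ract (theta e) lambda)) `<=` supp e].

Definition continuous_section (R : realType) (Y : topologicalType)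
    (F : hilbertC0Module R Y) (s : forall nu : Y, fibre F nu) :=
  forall (nu0 : Y) (eps : R[i]), 0 < eps ->
    exists f : F, \forall nu \near nu0, `|s nu - value nu f| < eps.

Definition homeomorphism (X Y : topologicalType) (f : X -> Y) :=
  exists g : Y -> X,
    [/\ cancel f g, cancel g f, continuous f & continuous g].

Definition Cb_nonneg (R : realType) (Y : topologicalType) (psi : Y -> R) :=
  [/\ continuous psi, bounded_fun psi & forall nu, 0 <= psi nu].

(* Main.v *)
(* If $e$ and $e'$ have disjoint carriers, rescaling the orthogonal
   sections $\theta(e)$, $\theta(e')$ to equal pointwise norm and using the
   orthogonality of sum and difference shows that $\theta(e)$, $\theta(e')$
   have disjoint carriers too; the same holds for $\theta^{-1}$.  A support
   point of $\nu$ is an $\omega$ such that $\theta(e)(\nu)$ depends only on the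
   germ of $e$ at $\omega$.  A gliding hump argument bounds
   $\|e\|$ from below at the support points of the $\nu$ with
   $\|\theta(e)(\nu)\| \ge \delta$.  Hence every $\nu$ has a support point
   $\sigma(\nu)$, none escapes to infinity, and $\theta(e)(\nu)$ depends only
   on $e(\sigma(\nu))$.  The induced linear maps between fibres preserve
   orthogonality, hence are multiples $\psi(\nu)$ of unitaries, and $\psi$ is
   bounded by the uniform boundedness principle. *)

Require Import Defs.
From HB Require Import structures.
From mathcomp Require Import all_boot all_order all_algebra complex.
From mathcomp Require Import boolp classical_sets functions reals topology.
From mathcomp Require Import normedtype.
From mathcomp Require Import sequences realfun ring lra.

Set Implicit Arguments.
Unset Strict Implicit.
Unset Printing Implicit Defensive.

Import Order.TTheory GRing.Theory Num.Theory numFieldNormedType.Exports.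

Local Open Scope classical_set_scope.
Local Open Scope ring_scope.

(** * Norms with real values *)

Section RealNorm.
Context {R : realType}.

Lemma normcE (z : R[i]) : 0 <= z -> z = (complex.Re z)%:C%C.
Proof. by move=> z0; rewrite RRe_real// ger0_real. Qed.

Lemma normr_real (r : R) : `|r%:C%C : R[i]| = (`|r|)%:C%C.
Proof. by rewrite normc_def/= expr0n/= addr0 sqrtr_sqr. Qed.

Section OneSpace.
Context {V : normedModType R[i]}.
Implicit Types x y : V.

Definition rnorm x : R := complex.Re `|x|.

Lemma rnormE x : `|x| = (rnorm x)%:C%C.
Proof. exact: normcE. Qed.

Lemma rnorm_ge0 x : 0 <= rnorm x.
Proof. by rewrite -lecR -rnormE normr_ge0. Qed.

Lemma rnorm_le x (M : R) : (rnorm x <= M) = (`|x| <= M%:C%C).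
Proof. by rewrite rnormE lecR. Qed.

Lemma rnormD x y : rnorm (x + y) <= rnorm x + rnorm y.
Proof. by rewrite -lecR rmorphD/= -!rnormE ler_normD. Qed.

Lemma rnormN x : rnorm (- x) = rnorm x.
Proof. by rewrite /rnorm normrN. Qed.

Lemma rnorm0 : rnorm 0 = 0.
Proof. by rewrite /rnorm normr0. Qed.

Lemma rnorm_eq0 x : (rnorm x == 0) = (x == 0).
Proof. by rewrite -(normr_eq0 x) rnormE (inj_eq (@complexI R) _ 0). Qed.

Lemma rnormB x y : rnorm x - rnorm y <= rnorm (x - y).
Proof. by rewrite lerBlDr (le_trans _ (rnormD _ _))// subrK. Qed.

Lemma rnormZ (a : R) x : rnorm (a%:C%C *: x) = `|a| * rnorm x.
Proof.
apply: (@complexI R).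
by rewrite -rnormE normrZ normr_real rnormE rmorphM.
Qed.

End OneSpace.

Lemma geometric_small (M r e : R) : 0 < r < 1 -> 0 < e ->
  exists n, M * r ^+ n < e.
Proof.
move=> /andP[r0 r1] e0; have rn : `|r| < 1 by rewrite gtr0_norm.
have /cvgrPdist_lt/(_ _ e0)[n _ /(_ n (leqnn n))] := cvg_geometric M rn.
by rewrite sub0r normrN => /(le_lt_trans (ler_norm _)); exists n.
Qed.

Lemma sum_geometric_cauchy (V : normedModType R[i]) (u : nat -> V) (M r : R) :
  0 < r < 1 -> (forall n, rnorm (u n) <= M * r ^+ n) ->
  forall m n, (n <= m)%N ->
    rnorm (\sum_(i < m) u i - \sum_(i < n) u i) <= M * r ^+ n / (1 - r).
Proof.
move=> /andP[r0 r1] uM m n nm.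
have M0 : 0 <= M by have := uM 0; rewrite expr0 mulr1; apply/le_trans/rnorm_ge0.
have d0 : 0 < 1 - r by rewrite subr_gt0.
(* The induction on [m] needs the exact finite geometric sum, hence the extra $-r^m$. *)
suff : rnorm (\sum_(i < m) u i - \sum_(i < n) u i)
     <= M * (r ^+ n - r ^+ m) / (1 - r).
  move=> /le_trans; apply; rewrite ler_pM2r ?invr_gt0// ler_wpM2l//.
  by rewrite lerBlDr lerDl exprn_ge0// ltW.
elim: m nm => [|m IH];
  first by rewrite leqn0 => /eqP->; rewrite !subrr rnorm0 mulr0 mul0r.
rewrite leq_eqVlt => /orP[/eqP->|]; first by rewrite !subrr rnorm0 mulr0 mul0r.
rewrite ltnS => /IH {}IH; rewrite big_ord_recr/= addrAC.
apply: (le_trans (rnormD _ _)); apply: (le_trans (lerD IH (uM m))).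
rewrite -[X in _ + X](mulfK (lt0r_neq0 d0)) -mulrDl ler_pM2r ?invr_gt0//.
by rewrite exprS; lra.
Qed.

Lemma sum_geometric (V : completeNormedModType R[i]) (u : nat -> V) (M r : R) :
  0 < r < 1 -> (forall n, rnorm (u n) <= M * r ^+ n) ->
  exists x, forall n, rnorm (x - \sum_(i < n) u i) <= M * r ^+ n / (1 - r).
Proof.
move=> r01 uM.
have cS : cauchy ((fun n => \sum_(i < n) u i) @ \oo).
  apply: cauchy_exP => eps eps0.
  have [n ne] := @geometric_small (M / (1 - r)) _ (complex.Re eps) r01
    ltac:(by rewrite -ltcR -normcE// ltW).
  exists (\sum_(i < n) u i); exists n => // m /= nm.
  rewrite -ball_normE/= rnormE [eps]normcE ?ltW// ltcR -rnormN opprB.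
  by apply: le_lt_trans (sum_geometric_cauchy r01 uM nm) _; rewrite mulrAC.
have /cvg_ex[x xS] : cvg ((fun n => \sum_(i < n) u i) @ \oo) by exact: cauchy_cvg.
exists x => n; apply/ler_addgt0Pr => e e0.
have /cvgrPdist_lt/(_ e%:C%C) := xS; rewrite ltcR => /(_ e0)[m _ mS].
have /mS : (m <= maxn m n)%N by rewrite leq_maxl.
rewrite rnormE ltcR => /ltW xm.
(* The partial sum at [maxn m n] is close to the limit and also covered by the tail bound at [n]. *)
rewrite -(subrK (\sum_(i < maxn m n) u i) x) -addrA addrC.
apply: (le_trans (rnormD _ _)); rewrite lerD//.
by apply: sum_geometric_cauchy r01 uM _ _ _; rewrite leq_maxr.
Qed.

End RealNorm.

(** * Truncation to the unit interval, the source of the cutoff functions *)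

Section Clamp.
Context {R : realType}.
Implicit Types t : R.

Definition clamp t := Num.max 0 (Num.min 1 t).

Lemma clamp_ge0 t : 0 <= clamp t.
Proof. by rewrite le_max lexx. Qed.

Lemma clamp_le1 t : clamp t <= 1.
Proof. by rewrite ge_max ler01 ge_min lexx. Qed.

Lemma clamp0 t : t <= 0 -> clamp t = 0.
Proof. by move=> t0; apply/max_idPl; rewrite ge_min t0 orbT. Qed.

Lemma clamp1 t : 1 <= t -> clamp t = 1.
Proof. by move=> t1; rewrite /clamp min_l// max_r. Qed.

Lemma clamp_continuous (T : topologicalType) (f : T -> R) :
  continuous f -> continuous (clamp \o f).
Proof.
move=> cf.
have -> : clamp \o f = (cst 0 : T -> R^o) \max ((cst 1 : T -> R^o) \min f) by [].
move=> x; apply: continuous_max; first exact: cvg_cst.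
by apply: continuous_min; [exact: cvg_cst|exact: cf].
Qed.

End Clamp.

(** * Functions vanishing at infinity and values of sections *)

Section C0Construction.
Context {R : realType} {X : topologicalType}.

Lemma c0_of_real (phi : X -> R) : continuous phi ->
  (forall eps, 0 < eps ->
    exists2 K, compact K & forall x, ~ K x -> `|phi x| < eps) ->
  exists a : C0 R X, forall x, a x = (phi x)%:C%C.
Proof.
move=> cphi vphi.
have phi0 : (fun x => (phi x)%:C%C) \in @c0_pred R X.
  apply/c0_predP; split=> [x|e e0].
    apply/cvgrPdist_lt => e e0; have re0 : 0 < complex.Re e.
      by rewrite -ltcR -normcE// ltW.
    have /cvgrPdist_lt/(_ _ re0) := cphi x.
    apply: filterS => y; rewrite -rmorphB normr_real [e]normcE ?ltW//.
    by rewrite ltcR.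
  have re0 : 0 < complex.Re e by rewrite -ltcR -normcE// ltW.
  have [K cK Kphi] := vphi _ re0; exists K => // x /Kphi.
  by rewrite normr_real [e]normcE ?ltW// ltcR.
by exists (MkC0 phi0).
Qed.

(** Complete regularity gives [f], zero at [w] and one off the interior of [U] cut with a compact
    neighbourhood. Truncating $2-3f$ yields 1 where $f<1/3$ and 0 where $f>2/3$. Being 1 near [w],
    and not only at [w], the bump preserves germs at [w]. *)
Lemma locally_compact_bump (w : X) (U : set X) :
  locally_compact [set: X] -> hausdorff_space X -> nbhs w U ->
  exists (a : C0 R X) (K : set X), [/\ compact K, closed K & K `<=` U] /\
    [/\ forall x, `|a x| <= 1, \forall x \near w, a x = 1 &
        forall x, ~ K x -> a x = 0].
Proof.
move=> lcX hX wU.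
have [L] := lcX w I; rewrite withinET => wL [cL clL].
have nB : ~ (~` (U `&` L)°) w by move=> /(_ (filterI wU wL)).
have clB : closed (~` (U `&` L)°) by apply: open_closedC; exact: open_interior.
have /(@uniform_separatorP _ R)[f [cf f01 fw fB]] :=
  @locally_compact_completely_regular _ R lcX hX _ _ clB nB.
have {}fw : f w = 0 by apply: fw; exists w.
have {}fB x : ~ (U `&` L)° x -> f x = 1 by move=> Bx; apply: fB; exists x.
pose phi x := clamp (2 - 3 * f x).
have cphi : continuous phi.
  apply: clamp_continuous => x; apply: cvgB; first exact: cvg_cst.
  by apply: cvgM; [exact: cvg_cst|exact: cf].
pose K := f @^-1` [set r | r <= 2 / 3].
have clK : closed K.
  by apply: (@preimage_closed _ _ f) => [x _|]; [exact: cf|exact: closed_le].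
have KUL : K `<=` U `&` L.
  move=> x fx; apply: (@interior_subset _ (U `&` L)); apply: contrapT => /fB fx1.
  by move: fx; rewrite /K/= fx1; lra.
have cK : compact K by apply: (subclosed_compact clK cL) => x /KUL[].
have phiK x : ~ K x -> phi x = 0.
  move=> /negP; rewrite /K/= -ltNge => fx.
  by apply: clamp0; lra.
have [a aE] : exists a : C0 R X, forall x, a x = (phi x)%:C%C.
  apply: c0_of_real => // e e0; exists K => // x /phiK ->.
  by rewrite normr0.
exists a, K; split; first by split=> // x /KUL[].
split=> [x||x /phiK]; last by rewrite aE => ->.
- by rewrite aE normr_real lecR ger0_norm ?clamp_ge0 ?clamp_le1.
- have /cvgrPdist_lt/(_ (1/3) ltac:(lra)) := cf w.
  apply: filterS => x; rewrite fw sub0r normrN aE => /ltr_normlW fx.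
  by rewrite /phi clamp1//; lra.
Qed.

End C0Construction.

Section ModuleBasics.
Context {R : realType} {X : topologicalType} {E : hilbertC0Module R X}.
Implicit Types (e x y : E) (w : X) (a : C0 R X).

Lemma value0 w : value w (0 : E) = 0.
Proof. by rewrite -[0 in LHS](scale0r 0) valueZ scale0r. Qed.

Lemma valueN w e : value w (- e) = - value w e.
Proof. by rewrite -scaleN1r valueZ scaleN1r. Qed.

Lemma valueB w x y : value w (x - y) = value w x - value w y.
Proof. by rewrite valueD valueN. Qed.

Lemma value_sum w (I : Type) (r : seq I) (P : pred I) (u : I -> E) :
  value w (\sum_(i <- r | P i) u i) = \sum_(i <- r | P i) value w (u i).
Proof. exact: (big_morph _ (valueD w) (value0 w)). Qed.

Lemma inner_value e w : inner e e w = (rnorm (value w e) ^+ 2)%:C%C.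
Proof.
rewrite rmorphXn/= -rnormE.
have -> : `|value w e| = sqrtC (fibre_inner (value w e) (value w e)) by [].
by rewrite sqrtCK fibre_innerE.
Qed.

Lemma value_eq0 e w : (value w e == 0) = (inner e e w == 0).
Proof.
by rewrite inner_value rmorphXn/= expf_eq0/= (inj_eq (@complexI R) _ 0) rnorm_eq0.
Qed.

Lemma inner_eq0l x y w : value w x = 0 -> inner x y w = 0.
Proof. by move=> /eqP; rewrite value_eq0 => x0; exact: inner_null. Qed.

Lemma inner_eq0r x y w : value w y = 0 -> inner x y w = 0.
Proof. by move=> y0; rewrite -inner_conj/= inner_eq0l// conjC0. Qed.

Lemma innerC x y w : inner y x w = (inner x y w)^*.
Proof. by rewrite -inner_conj. Qed.

Lemma innerDl x y z w : inner (x + y) z w = inner x z w + inner y z w.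
Proof. by rewrite innerC innerDr c0DE rmorphD/= -!innerC. Qed.

Lemma innerZl c x y w : inner (c *: x) y w = c^* * inner x y w.
Proof. by rewrite innerC innerZr c0ZE rmorphM/= -innerC. Qed.

Lemma innerNr x y w : inner x (- y) w = - inner x y w.
Proof. by rewrite -scaleN1r innerZr c0ZE mulN1r. Qed.

Lemma inner_sqrD x y w : inner x y w = 0 ->
  inner (x + y) (x + y) w = inner x x w + inner y y w.
Proof.
move=> xy0; rewrite innerDr c0DE !innerDl (innerC x y) xy0 conjC0.
by rewrite addr0 add0r.
Qed.

Lemma inner_ractl x y a w : inner (ract x a) y w = (a w)^* * inner x y w.
Proof. by rewrite innerC inner_ract/= rmorphM/= -innerC mulrC. Qed.

Lemma inner_ractr x y a w : inner x (ract y a) w = a w * inner x y w.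
Proof. by rewrite inner_ract/= mulrC. Qed.

Lemma value_ract e a w : value w (ract e a) = a w *: value w e.
Proof.
apply/eqP; rewrite -subr_eq0 -valueZ -valueB value_eq0.
rewrite innerDr c0DE innerNr innerZr c0ZE inner_ractr.
by rewrite subrr.
Qed.

Lemma value_inj x y : (forall w, value w x = value w y) -> x = y.
Proof.
move=> xy; apply/eqP; rewrite -subr_eq0; apply/eqP/inner_eq0/c0P => w.
by apply/eqP; rewrite -value_eq0 valueB xy subrr.
Qed.

Lemma module_eq0 e : (forall w, value w e = 0) -> e = 0.
Proof. by move=> e0; apply: value_inj => w; rewrite e0 value0. Qed.

Lemma rnorm_value_continuous e : continuous (fun w => rnorm (value w e)).
Proof.
have -> : (fun w => rnorm (value w e))
    = Num.sqrt \o (fun w => complex.Re (inner e e w)).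
  by apply/funext => w /=; rewrite inner_value/= sqrtr_sqr ger0_norm ?rnorm_ge0.
move=> w; apply: continuous_comp; last exact: sqrt_continuous.
have /c0_predP[ce _] := c0_funP (inner e e).
apply/cvgrPdist_lt => eps eps0.
have /cvgrPdist_lt/(_ eps%:C%C) := ce w; rewrite ltcR => /(_ eps0).
apply: filterS => v; rewrite -ltcR => /(le_lt_trans _); apply.
by rewrite -raddfB normc_ge_Re.
Qed.

Lemma rnorm_module_sqr e : rnorm e ^+ 2 = rnorm (inner e e).
Proof.
by apply: complexI; rewrite rmorphXn/= -!rnormE hilbert_normE sqrtCK.
Qed.

(** Together with [rnorm_module_le] this identifies the module norm with the supremum of the fibre
    norms. *)
Lemma rnorm_value_le e w : rnorm (value w e) <= rnorm e.
Proof.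
rewrite -(@ler_pXn2r _ 2)// ?nnegrE ?rnorm_ge0// rnorm_module_sqr.
rewrite -lecR -rnormE -inner_value.
apply: le_trans (ler_c0_norm (inner e e) w).
by rewrite real_ler_norm// ger0_real// inner_ge0.
Qed.

Lemma rnorm_module_le e M : 0 <= M ->
  (forall w, rnorm (value w e) <= M) -> rnorm e <= M.
Proof.
move=> M0 eM; rewrite -(@ler_pXn2r _ 2)// ?nnegrE ?rnorm_ge0// rnorm_module_sqr.
rewrite rnorm_le; apply: c0_norm_le; first exact: exprn_ge0.
move=> w; rewrite inner_value normr_real lecR ger0_norm ?exprn_ge0 ?rnorm_ge0//.
by rewrite ler_pXn2r ?nnegrE ?rnorm_ge0.
Qed.

Lemma rnorm_value_ge_compact e eps : 0 < eps ->
  compact [set w | eps <= rnorm (value w e)].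
Proof.
move=> eps0; have /c0_predP[_ ve] := c0_funP (inner e e).
have [K cK Ke] := ve ((eps ^+ 2)%:C%C) ltac:(by rewrite ltcR exprn_gt0).
apply: (subclosed_compact _ cK).
  apply: (@preimage_closed _ _ (fun w => rnorm (value w e)) [set r | eps <= r]).
    by move=> w _; exact: rnorm_value_continuous.
  exact: closed_ge.
move=> w /= ew; apply: contrapT => /Ke; rewrite inner_value normr_real ltcR.
rewrite ger0_norm ?exprn_ge0 ?rnorm_ge0// ltr_pXn2r ?nnegrE ?rnorm_ge0 ?(ltW eps0)//.
by rewrite ltNge ew.
Qed.

End ModuleBasics.

(** * Carriers, supports and nonzero fibres *)

Section Carriers.
Context {R : realType} {X : topologicalType} {E : hilbertC0Module R X}.
Implicit Types (e x y : E) (w : X).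

Definition carrier e : set X := [set w | value w e != 0].

Definition disjoint_carriers x y := forall w, value w x = 0 \/ value w y = 0.

Lemma carrier_gtP e w : carrier e w <-> 0 < rnorm (value w e).
Proof. by rewrite lt_def rnorm_ge0 andbT rnorm_eq0. Qed.

Lemma rnorm_value_gt_nbhs e w (r : R) : r < rnorm (value w e) ->
  \forall v \near w, r < rnorm (value v e).
Proof.
move=> rw; have := @rnorm_value_continuous _ _ _ e w.
by move=> /cvgr_gt/(_ _ rw).
Qed.

Lemma rnorm_value_lt_nbhs e w (r : R) : rnorm (value w e) < r ->
  \forall v \near w, rnorm (value v e) < r.
Proof.
move=> rw; have := @rnorm_value_continuous _ _ _ e w.
by move=> /cvgr_lt/(_ _ rw).
Qed.

Lemma carrier_nbhs e w : carrier e w -> nbhs w (carrier e).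
Proof.
move=> /carrier_gtP/rnorm_value_gt_nbhs; apply: filterS => v.
by move=> /carrier_gtP.
Qed.

Lemma carrier_supp e : carrier e `<=` supp e.
Proof. exact: subset_closure. Qed.

Lemma not_suppP e w : ~ supp e w <-> \forall v \near w, value v e = 0.
Proof.
split.
  move=> /existsNP[U /not_implyP[wU]].
  move=> nU; near=> v; apply: contrapT => /eqP ev.
  by apply: nU; exists v; split=> //; near: v.
move=> w0 /(_ _ w0)[v [/= /negP]].
by move=> ev ev0; apply: ev; rewrite ev0.
Unshelve. all: by end_near. Qed.

Lemma supp_sub_closed e (K : set X) : closed K ->
  (forall w, ~ K w -> value w e = 0) -> supp e `<=` K.
Proof.
move=> clK eK; move/closure_id: clK => ->; apply: closureS => w /= ew.
by apply: contrapT => /eK ew0; rewrite ew0 eqxx in ew.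
Qed.

Lemma supp_ract_sub e (a : C0 R X) (K : set X) : closed K ->
  (forall w, ~ K w -> a w = 0) -> supp (ract e a) `<=` K.
Proof.
move=> clK aK; apply: supp_sub_closed => // w /aK aw.
by rewrite value_ract aw scale0r.
Qed.

Lemma carrier_ract_sub e (a : C0 R X) : carrier (ract e a) `<=` carrier e.
Proof.
by move=> w; rewrite /carrier/= value_ract scaler_eq0 negb_or => /andP[].
Qed.

(** Since [h 0 = 0], the composite is small wherever the norm of [e] is small, and the remaining set
    is compact. *)
Lemma c0_of_rnorm (h : R -> R) e : continuous h -> h 0 = 0 ->
  exists a : C0 R X, forall w, a w = (h (rnorm (value w e)))%:C%C.
Proof.
move=> ch h0; apply: c0_of_real.
  by move=> w; apply: continuous_comp; [exact: rnorm_value_continuous|exact: ch].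
move=> eps eps0; have /cvgrPdist_lt/(_ _ eps0)/nbhs_ballP[d /= d0 dh] := ch 0.
exists [set w | d <= rnorm (value w e)].
  exact: rnorm_value_ge_compact.
move=> w /negP; rewrite /= -ltNge => wd.
have /dh : ball 0 d (rnorm (value w e)).
  by rewrite -ball_normE/= sub0r normrN ger0_norm ?rnorm_ge0.
by rewrite h0 sub0r normrN.
Qed.

(** If every value at [w] were zero, all elements of the dense span would vanish at [w], and none
    could come within distance 1 of a bump equal to 1 there. *)
Lemma full_value_neq0 : locally_compact [set: X] -> hausdorff_space X ->
  full_module E -> forall w, exists e, value w e != 0.
Proof.
move=> lcX hX fullE w.
have [a [_ [_ [_ /nbhs_singleton aw _]]]] :=
  @locally_compact_bump R X w setT lcX hX filterT.
have [//||h [hB [n [c [e [f hE]]]]]] := fullE (ball a 1).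
- by exists a; exact: ballxx.
- exact: ball_open.
apply: contrapT => /forallNP e0; have {}e0 x : value w x = 0.
  by have /negP := e0 x; rewrite negbK => /eqP.
have hw : h w = 0.
  rewrite hE; have -> : (\sum_(i < n) c i *: inner (e i) (f i)) w
     = \sum_(i < n) (c i *: inner (e i) (f i)) w.
    by apply: (big_morph (fun g : C0 R X => g w)) => //.
  by rewrite big1// => i _; rewrite c0ZE inner_eq0l ?mulr0.
move: hB; rewrite -ball_normE/= => /(le_lt_trans (ler_c0_norm (a - h) w)).
have -> : (a - h) w = a w - h w by [].
by rewrite hw aw subr0 normr1 ltxx.
Qed.

End Carriers.

(** The hypotheses, bundled symmetrically in the map and its inverse, so that each result transfers
    to the inverse by [local_ortho_iso_sym]. *)
Record local_ortho_iso (R : realType) (X Y : topologicalType)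
    (E : hilbertC0Module R X) (F : hilbertC0Module R Y)
    (theta : {linear E -> F}) (thetai : {linear F -> E}) : Prop := LocalOrthoIso {
  lcl : locally_compact [set: X];
  hsl : hausdorff_space X;
  lcr : locally_compact [set: Y];
  hsr : hausdorff_space Y;
  fulll : full_module E;
  fullr : full_module F;
  isoK : cancel theta thetai;
  isoVK : cancel thetai theta;
  local : forall e a, supp (thetai (ract (theta e) a)) `<=` supp e;
  localV : forall f a, supp (theta (ract (thetai f) a)) `<=` supp f;
  ortho : orthogonality_preserving theta;
  orthoV : orthogonality_preserving thetai
}.

Lemma local_ortho_iso_sym (R : realType) (X Y : topologicalType)
    (E : hilbertC0Module R X) (F : hilbertC0Module R Y)
    (theta : {linear E -> F}) (thetai : {linear F -> E}) :
  local_ortho_iso theta thetai -> local_ortho_iso thetai theta.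
Proof. by case. Qed.

(** * Separation of carriers *)

Section Separation.
Context {R : realType} {X Y : topologicalType}.
Context {E : hilbertC0Module R X} {F : hilbertC0Module R Y}.
Context {theta : {linear E -> F}} {thetai : {linear F -> E}}.

(* Rescaling $\theta(e)$ and $\theta(e')$ to orthogonal sections $p$, $p'$ of
   equal pointwise norm makes $p + p'$ orthogonal to $p - p'$; pulled back to
   [E], where the two supports are separated, this forces $p = 0$. *)
Lemma disjoint_carriers_image : local_ortho_iso theta thetai ->
  forall e e', disjoint_carriers e e' -> disjoint_carriers (theta e) (theta e').
Proof.
move=> H e e' dee' nu.
have ip0 : inner (theta e) (theta e') = 0.
  apply: (ortho H); apply: c0P => w.
  by case: (dee' w) => w0; [exact: inner_eq0l|exact: inner_eq0r].
have [a aE] := @c0_of_rnorm _ _ _ id (theta e') (fun x => cvg_id) erefl.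
have [a' a'E] := @c0_of_rnorm _ _ _ id (theta e) (fun x => cvg_id) erefl.
pose p := ract (theta e) a; pose p' := ract (theta e') a'.
have ipp' w : inner p p' w = 0.
  by rewrite inner_ractl inner_ractr ip0 !mulr0.
have pp' : inner (p + p') (p - p') = 0.
  apply: c0P => w; rewrite innerDr c0DE !innerDl !innerNr.
  rewrite [inner p' p w]innerC ipp' conjC0 addr0 oppr0 add0r !inner_value.
  by rewrite !value_ract aE a'E !rnormZ !ger0_norm ?rnorm_ge0// mulrC subrr.
have gg' : inner (thetai p + thetai p') (thetai p - thetai p') = 0.
  by rewrite -raddfD -raddfB; exact: (orthoV H).
(* Near a carrier point of [thetai p], locality gives [v] where [e] is nonzero too. There
   [thetai p'] vanishes, since otherwise [e] and [e'] would both be nonzero at some point near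
   [v]. *)
have g0 : thetai p = 0.
  apply: module_eq0 => w; apply: contrapT => /eqP gw.
  have [v [/= ev gv]] := local H (carrier_supp gw) (carrier_nbhs gw).
  have g'v : value v (thetai p') = 0.
    apply: contrapT => /eqP g'v.
    have [u [/= /eqP e'u /eqP eu]] := local H (carrier_supp g'v) (carrier_nbhs ev).
    by case: (dee' u).
  have /eqP := congr1 (fun h : C0 R X => h v) gg'.
  rewrite /= innerDr c0DE !innerDl !innerNr.
  rewrite !(inner_eq0l _ g'v) !(inner_eq0r _ g'v) oppr0 !addr0.
  by rewrite -value_eq0; apply/negP.
have /(congr1 (value nu)) : p = 0 by rewrite -(isoVK H p) g0 raddf0.
rewrite value_ract value0 aE => /eqP; rewrite scaler_eq0 => /orP[|/eqP]; last by left.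
by rewrite (inj_eq (@complexI R) _ 0) rnorm_eq0 => /eqP; right.
Qed.

End Separation.

Section CarrierInclusion.
Context {R : realType} {X Y : topologicalType}.
Context {E : hilbertC0Module R X} {F : hilbertC0Module R Y}.
Context {theta : {linear E -> F}} {thetai : {linear F -> E}}.

(** Otherwise cut [theta e] off to a region where [theta e'] vanishes. By separation for the
    inverse, the preimage [d] has carrier disjoint from that of [e']; by locality it lives in
    [supp e], where the carrier of [e'] is dense. Hence [d] is zero, a contradiction. *)
Lemma carrier_image_sub : local_ortho_iso theta thetai ->
  forall e e', carrier e `<=` supp e' -> carrier (theta e) `<=` supp (theta e').
Proof.
move=> H e e' ee' nu /= enu; apply: contrapT => /not_suppP nu0.
have [a [K [[_ _ KU] [_ /nbhs_singleton anu aK]]]] :=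
  @locally_compact_bump R Y nu [set v | value v (theta e') = 0] (lcr H) (hsr H) nu0.
pose d := thetai (ract (theta e) a).
have dE : theta d = ract (theta e) a by rewrite /d (isoVK H).
have de' : disjoint_carriers d e'.
  rewrite -[d](isoK H) -[e'](isoK H).
  apply: (disjoint_carriers_image (local_ortho_iso_sym H)) => v; rewrite dE value_ract.
  have [/KU v0|/aK ->] := pselect (K v); [by right|by left; rewrite scale0r].
have d0 : d = 0.
  apply: module_eq0 => w; apply: contrapT => /eqP dw.
  have [v [/= ev dv]] := local H (carrier_supp dw) (carrier_nbhs dw).
  have [u [/= /eqP e'u /eqP du]] := ee' _ ev _ (carrier_nbhs dv).
  by case: (de' u).
move: enu; have /(congr1 (value nu)) := dE.
by rewrite d0 raddf0 value0 value_ract anu scale1r /carrier/= => <-; rewrite eqxx.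
Qed.

Lemma supp_image_sub : local_ortho_iso theta thetai ->
  forall e e', carrier e `<=` supp e' -> supp (theta e) `<=` supp (theta e').
Proof.
move=> H e e' /(carrier_image_sub H)/closureS ee' nu /ee'.
exact: closed_closure.
Qed.

End CarrierInclusion.

(** * Support points *)

Section SupportPoints.
Context {R : realType} {X Y : topologicalType}.
Context {E : hilbertC0Module R X} {F : hilbertC0Module R Y}.
Context {theta : {linear E -> F}} {thetai : {linear F -> E}}.

Definition support_point (theta : E -> F) (nu : Y) (w : X) :=
  forall e, ~ supp e w -> value nu (theta e) = 0.

Context (H : local_ortho_iso theta thetai).
Let H' := local_ortho_iso_sym H.

Lemma point_bump (w : X) (U : set X) : nbhs w U ->
  exists (a : C0 R X) (K : set X), [/\ compact K, closed K & K `<=` U] /\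
    [/\ forall x, `|a x| <= 1, \forall x \near w, a x = 1 &
        forall x, ~ K x -> a x = 0].
Proof. exact: locally_compact_bump (lcl H) (hsl H). Qed.

(** The difference of [ract e a] and [e] vanishes near [w]. *)
Lemma support_point_localize nu (w : X) (a : C0 R X) e : support_point theta nu w ->
  (\forall x \near w, value x e = 0 \/ a x = 1) ->
  value nu (theta (ract e a)) = value nu (theta e).
Proof.
move=> spw aw; apply/eqP; rewrite -subr_eq0 -valueB -raddfB; apply/eqP/spw.
apply/not_suppP; apply: filterS aw => x; rewrite valueB value_ract.
by case=> ->; rewrite ?scaler0 ?scale1r subrr.
Qed.

Lemma image_neq0 nu : exists e, value nu (theta e) != 0.
Proof.
have [f fnu] := full_value_neq0 (lcr H) (hsr H) (fullr H) nu.
by exists (thetai f); rewrite (isoVK H).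
Qed.

Lemma carrier_preimage nu f : value nu f != 0 -> exists w, carrier (thetai f) w.
Proof.
move=> fnu; apply: contrapT => /forallNP f0; move: fnu.
rewrite -[f](isoVK H) [thetai f]module_eq0 ?raddf0 ?value0 ?eqxx// => w.
by have /negP := f0 w; rewrite negbK => /eqP.
Qed.

(** The supports of all [d] with [theta d] nonzero at [nu] form a filter base. Compactness of
    [supp e] provides a cluster point; it lies in each of these closed supports, which is what a
    support point requires. *)
Lemma support_point_exists e nu : compact (supp e) ->
  value nu (theta e) != 0 -> exists2 w, supp e w & support_point theta nu w.
Proof.
move=> cpt enu.
pose G := [set A | exists2 d, value nu (theta d) != 0 & supp d `<=` A].
have GF : ProperFilter G.
  apply: Build_ProperFilter_ex.
    move=> A [d dnu dA]; apply: contrapT => A0.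
    move: dnu; have -> : d = 0.
      apply: module_eq0 => w; apply: contrapT => /eqP/carrier_supp/dA Aw.
      by apply: A0; exists w.
    by rewrite raddf0 value0 eqxx.
  split; first by exists e.
    move=> A B [d dnu dA] [d' d'nu d'B].
    (* Locality puts [supp c] inside [supp d]; carrier inclusion for [thetai] puts it inside
       [supp d']. *)
    pose c := thetai (ract (theta d) (inner (theta d') (theta d'))).
    exists c.
      by rewrite /c (isoVK H) value_ract scaler_eq0 -value_eq0 negb_or d'nu.
    move=> w cw; split; first exact/dA/(local H cw).
    apply/d'B; rewrite -[d'](isoK H); move: w cw.
    apply: (supp_image_sub H').
    move=> v; rewrite /carrier/= value_ract scaler_eq0 negb_or -value_eq0 => /andP[d'v _].
    exact: carrier_supp.
  by move=> A B AB [d dnu dA]; exists d => // w /dA/AB.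
have [|w [ew Gw]] := cpt G GF; first by exists e.
have dw d : value nu (theta d) != 0 -> supp d w.
  move=> dnu; apply: closed_closure.
  by move=> U wU; apply: Gw => //; exists d.
exists w => // d dw0; apply: contrapT => /eqP dnu; exact/dw0/dw.
Qed.

End SupportPoints.

Section SupportMap.
Context {R : realType} {X Y : topologicalType}.
Context {E : hilbertC0Module R X} {F : hilbertC0Module R Y}.
Context {theta : {linear E -> F}} {thetai : {linear F -> E}}.
Context (H : local_ortho_iso theta thetai).
Let H' := local_ortho_iso_sym H.

(** Cut [e] off to [U] without changing its germ at [w]: the image stays nonzero near [nu], whereas
    a support point outside [U] would make it zero. Quantifying over all support points avoids any
    appeal to uniqueness. *)
Lemma support_point_continuous nu (w : X) (U : set X) :
  support_point theta nu w -> nbhs w U ->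
  \forall nu' \near nu, forall w', support_point theta nu' w' -> U w'.
Proof.
move=> sw wU; have [e enu] := image_neq0 H nu.
have [a [K [[_ clK KU] [_ aw aK]]]] := point_bump H wU.
move: enu; rewrite -(support_point_localize (a := a) sw); last first.
  by apply: filterS aw => x ->; right.
move=> /carrier_nbhs; apply: filterS => nu' /eqP enu' w' sw'.
by apply: contrapT => nUw'; apply/enu'/sw' => /(supp_ract_sub clK aK)/KU.
Qed.

(** A compactly supported piece of [thetai f] near [w0] has a nonzero image, so it yields a support
    point; carrier inclusion places [nu] in [supp f]. *)
Lemma carrier_support_point f (w0 : X) (W : set X) :
  nbhs w0 W -> carrier (thetai f) w0 ->
  exists nu w, [/\ supp f nu, W w & support_point theta nu w].
Proof.
move=> w0W fw0; have [a [K [[cK clK KW] [_ /nbhs_singleton aw0 aK]]]] := point_bump H w0W.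
pose e := ract (thetai f) a.
have eK : supp e `<=` K by exact: supp_ract_sub.
have [nu enu] : exists nu, carrier (theta e) nu.
  rewrite -[e](isoK H); apply: (@carrier_preimage _ _ _ _ _ _ _ H' w0).
  by rewrite (isoK H) value_ract aw0 scale1r.
have ce : compact (supp e) by apply: subclosed_compact cK eK; exact: closed_closure.
have [w ew sw] := support_point_exists H ce enu.
exists nu, w; split=> //; last exact/KW/eK.
rewrite -[f](isoVK H); apply: (carrier_image_sub H) enu => v /carrier_ract_sub.
exact: carrier_supp.
Qed.

Lemma support_point_dense (nu0 : Y) (V : set Y) : nbhs nu0 V ->
  exists nu w, V nu /\ support_point theta nu w.
Proof.
move=> nu0V; have [f fnu0] := full_value_neq0 (lcr H) (hsr H) (fullr H) nu0.
have [a [K [[_ clK KV] [_ /nbhs_singleton anu0 aK]]]] := point_bump H' nu0V.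
have [w0 fw0] : exists w0, carrier (thetai (ract f a)) w0.
  by apply: (@carrier_preimage _ _ _ _ _ _ _ H nu0); rewrite value_ract anu0 scale1r.
have [nu [w [fnu _ sw]]] := carrier_support_point filterT fw0.
by exists nu, w; split=> //; exact/KV/(supp_ract_sub clK aK fnu).
Qed.

(** If [theta e] were nonzero at [nu], its restriction to a small neighbourhood would pull back, by
    locality, to something meeting the carrier of [e]; a support point found there contradicts the
    assumption. *)
Lemma image_eq0_near nu e :
  (\forall nu' \near nu, forall w', support_point theta nu' w' -> value w' e = 0) ->
  value nu (theta e) = 0.
Proof.
move=> e0; apply: contrapT => /eqP enu.
pose V := [set nu' | forall w', support_point theta nu' w' -> value w' e = 0].
have [a [K [[_ clK KV] [_ /nbhs_singleton anu aK]]]] := @point_bump _ _ _ _ _ _ _ H' nu V e0.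
pose f := ract (theta e) a.
have [w0 fw0] : exists w0, carrier (thetai f) w0.
  by apply: (@carrier_preimage _ _ _ _ _ _ _ H nu); rewrite value_ract anu scale1r.
have [w1 [ew1 fw1]] := local H (carrier_supp fw0) (carrier_nbhs fw0).
have [nu' [w' [fnu' ew' sw']]] := carrier_support_point (carrier_nbhs ew1) fw1.
have /KV/(_ _ sw')/eqP := supp_ract_sub clK aK fnu'.
by apply/negP.
Qed.

End SupportMap.

(** * The gliding hump and its consequences *)

Section Humps.
Context {R : realType} {X Y : topologicalType}.
Context {E : hilbertC0Module R X} {F : hilbertC0Module R Y}.
Context {theta : {linear E -> F}} {thetai : {linear F -> E}}.

(* Gliding hump: if the bound failed along points $w_n$ with
   $\|e(w_n)\|$ decreasing geometrically, the series of disjointly supported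
   pieces of [e], scaled by $2^n$ near $w_n$, would converge in [E] to an
   element with an unbounded image. *)
Lemma support_point_lower_bound e (d : R) : 0 < d ->
  exists2 eps : R, 0 < eps & forall nu w, support_point theta nu w ->
    d <= rnorm (value nu (theta e)) -> value w e != 0 ->
    eps <= rnorm (value w e).
Proof.
move=> d0; apply: contrapT => bad.
have {}bad (eps : R) : 0 < eps -> exists p : Y * X,
    [/\ support_point theta p.1 p.2, d <= rnorm (value p.1 (theta e)) &
        0 < rnorm (value p.2 e) < eps].
  move=> eps0; apply: contrapT => /forallNP noP; apply: bad; exists eps => //.
  move=> nu w sw dnu ew; rewrite leNgt; apply/negP => we; apply: (noP (nu, w)).
  by split=> //; rewrite we andbT; exact/carrier_gtP.
have [p0 _] := bad 1 ltr01.
have /choice[N Nbad] : forall eps : R, exists p : Y * X, 0 < eps ->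
    [/\ support_point theta p.1 p.2, d <= rnorm (value p.1 (theta e)) &
        0 < rnorm (value p.2 e) < eps].
  move=> eps; have [/bad[p pP]|_] := boolP (0 < eps); [by exists p|by exists p0].
(* The factor 4 makes the windows $(t_n/2, 3t_n/2)$ pairwise disjoint. *)
pose fix eps n : R := if n is m.+1 then rnorm (value (N (eps m)).2 e) / 4 else 1.
have eps0 n : 0 < eps n.
  elim: n => //= n /Nbad[_ _ /andP[t0 _]]; exact: divr_gt0.
pose nu n := (N (eps n)).1; pose w n := (N (eps n)).2.
pose t n := rnorm (value (w n) e).
have sw n : support_point theta (nu n) (w n) by have [] := Nbad _ (eps0 n).
have dnu n : d <= rnorm (value (nu n) (theta e)) by have [] := Nbad _ (eps0 n).
have t0 n : 0 < t n by have [_ _ /andP[]] := Nbad _ (eps0 n).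
have t_lt n : t n < eps n by have [_ _ /andP[]] := Nbad _ (eps0 n).
have tS n : t n.+1 < t n / 4 by exact: t_lt.
have t_small n : t n <= 4^-1 ^+ n.
  apply/ltW/(lt_le_trans (t_lt n)); elim: n => [|n IH]; first by rewrite expr0.
  by rewrite /= exprSr ler_pM2r ?invr_gt0// (le_trans _ IH)// ltW// t_lt.
have t_mono m n : (m < n)%N -> t n < t m / 4.
  elim: n => // n IH; rewrite ltnS leq_eqVlt => /orP[/eqP->//|/IH tn].
  by apply: (lt_trans (tS n)); have := t0 n; lra.
(* A trapezoid: 1 on $[3t_n/4, 5t_n/4]$ and 0 outside the window $(t_n/2, 3t_n/2)$. *)
pose h n s := clamp (2 - 4 / t n * `|s - t n|).
have h_continuous n : continuous (h n).
  apply: clamp_continuous => s; apply: cvgB; first exact: cvg_cst.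
  apply: cvgM; first exact: cvg_cst.
  by apply: cvg_norm; apply: cvgB; [exact: cvg_id|exact: cvg_cst].
have h_eq0 n s : t n / 2 <= `|s - t n| -> h n s = 0.
  move=> st; apply: clamp0.
  have : 4 / t n * (t n / 2) <= 4 / t n * `|s - t n|.
    by rewrite ler_pM2l// divr_gt0.
  have -> : 4 / t n * (t n / 2) = 2 by field; exact: (lt0r_neq0 (t0 n)).
  lra.
have h_eq1 n s : `|s - t n| <= t n / 4 -> h n s = 1.
  move=> st; apply: clamp1.
  have : 4 / t n * `|s - t n| <= 4 / t n * (t n / 4).
    by rewrite ler_pM2l// divr_gt0.
  have -> : 4 / t n * (t n / 4) = 1 by field; exact: (lt0r_neq0 (t0 n)).
  lra.
have h0 n : h n 0 = 0.
  by apply: h_eq0; rewrite sub0r normrN gtr0_norm//; have := t0 n; lra.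
have /choice[a aE] : forall n, exists a : C0 R X,
    forall x, a x = (h n (rnorm (value x e)))%:C%C.
  by move=> n; exact: c0_of_rnorm.
(* The piece [ract e (a n)] has norm at most $2t_n \le 2\cdot 4^{-n}$, so the weight $2^n$ still
   leaves a convergent series. *)
pose u n := (2 ^+ n : R)%:C%C *: ract e (a n).
have pow0 n : 0 < 2 ^+ n :> R by rewrite exprn_gt0.
have uM n : rnorm (u n) <= 2 * 2^-1 ^+ n.
  rewrite rnormZ (ger0_norm (ltW (pow0 n))) -ler_pdivlMl//.
  have -> : (2 ^+ n)^-1 * (2 * 2^-1 ^+ n) = 2 * 4^-1 ^+ n :> R.
    by rewrite -exprVn mulrCA -exprMn -invfM -natrM.
  apply: rnorm_module_le => [|x]; first by rewrite mulr_ge0// exprn_ge0// invr_ge0.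
  apply: le_trans (_ : 2 * t n <= _); last by rewrite ler_pM2l.
  rewrite value_ract aE rnormZ ger0_norm ?clamp_ge0//.
  have [xt|tx] := leP (rnorm (value x e)) (2 * t n).
    apply: le_trans xt; rewrite ler_piMl ?rnorm_ge0 ?clamp_le1//.
  rewrite h_eq0 ?mul0r ?mulr_ge0 ?(ltW (t0 n))//.
  by rewrite ler_normr; apply/orP; left; have := t0 n; lra.
have half : 0 < (2^-1 : R) < 1 by lra.
have [k kE] := sum_geometric half uM.
have k_local n : \forall x \near w n, value x k = value x ((2 ^+ n : R)%:C%C *: e).
  have tn := t0 n.
  have := @rnorm_value_gt_nbhs _ _ _ e (w n) (3 / 4 * t n)
    ltac:(by rewrite -/(t n); lra).
  have := @rnorm_value_lt_nbhs _ _ _ e (w n) (5 / 4 * t n)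
    ltac:(by rewrite -/(t n); lra).
  apply: filterS2 => x xlt xgt.
  have sumE m : (n < m)%N -> value x (\sum_(i < m) u i)
      = value x ((2 ^+ n : R)%:C%C *: e).
    move=> nm; rewrite value_sum (bigD1 (Ordinal nm))//= big1 ?addr0.
      rewrite /u !valueZ value_ract aE h_eq1 ?scale1r//.
      by rewrite ler_norml; lra.
    move=> i /negP ni; rewrite /u valueZ value_ract aE h_eq0 ?scale0r ?scaler0//.
    have ti := t0 i.
    have : (i < n)%N \/ (n < i)%N.
      by apply/orP; rewrite -neq_ltn; apply/negP => /eqP ni'; apply/ni/eqP/val_inj.
    rewrite ler_normr => -[/t_mono tni|/t_mono tin]; apply/orP; [right|left]; lra.
  (* At [x] all partial sums past [n] agree, so the remainder lies below every geometric tail and is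
     zero. *)
  apply/eqP; rewrite -subr_eq0 -rnorm_eq0 eq_le rnorm_ge0 andbT leNgt.
  apply/negP => r0.
  have [m mr] := @geometric_small R (4 * 2^-1 ^+ n.+1) _ _ half r0.
  have := rnorm_value_le (k - \sum_(i < n.+1 + m) u i) x.
  rewrite valueB sumE ?ltn_addr// => /le_trans/(_ (kE _))/(lt_le_trans mr).
  rewrite exprD; set A := _ ^+ n.+1; set B := _ ^+ m.
  have -> : 2 * (A * B) / (1 - 2^-1) = 4 * A * B by field.
  by rewrite ltxx.
have [m mB] := @geometric_small R (rnorm (theta k)) _ _ half d0.
move: mB; apply/negP; rewrite -leNgt exprVn ler_pdivlMr// mulrC.
(* Equality of germs at the support point passes to the images, forcing $\|\theta(k)\| \ge 2^m d$
   for every [m]. *)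
have kn : value (nu m) (theta k) = (2 ^+ m : R)%:C%C *: value (nu m) (theta e).
  apply/eqP; rewrite -subr_eq0 -valueZ -valueB -linearZ -raddfB; apply/eqP/(sw m).
  apply/not_suppP; apply: filterS (k_local m) => x xk.
  by rewrite valueB xk subrr.
have := rnorm_value_le (theta k) (nu m).
rewrite kn rnormZ ger0_norm ?(ltW (pow0 m))//; apply: le_trans.
by rewrite ler_pM2l.
Qed.

End Humps.

(** * From germs to values, and existence of support points everywhere *)

Section SupportPointMap.
Context {R : realType} {X Y : topologicalType}.
Context {E : hilbertC0Module R X} {F : hilbertC0Module R Y}.
Context {theta : {linear E -> F}} {thetai : {linear F -> E}}.
Context (H : local_ortho_iso theta thetai).

(** Removes the proviso that [e] is nonzero at [w]. If $\|e(w)\|$ were below the bound for [d / 2],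
    then by continuity [e] would vanish at all support points of nearby $\nu'$, and [theta e] would
    vanish at [nu]. *)
Lemma support_point_bound e (d : R) : 0 < d ->
  exists2 eps : R, 0 < eps & forall nu w, support_point theta nu w ->
    d <= rnorm (value nu (theta e)) -> eps <= rnorm (value w e).
Proof.
move=> d0; have d20 : 0 < d / 2 by rewrite divr_gt0.
have [eps eps0 He] := @support_point_lower_bound _ _ _ _ _ theta e _ d20.
exists eps => // nu w sw dnu; rewrite leNgt; apply/negP => we.
have : value nu (theta e) = 0.
  apply: (image_eq0_near H).
  have := support_point_continuous H sw (rnorm_value_lt_nbhs we).
  have := @rnorm_value_gt_nbhs _ _ _ (theta e) nu (d / 2) ltac:(lra).
  apply: filterS2 => nu' /ltW dnu' small w' sw'; apply: contrapT => /eqP ew'.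
  by have := He _ _ sw' dnu' ew'; rewrite leNgt small.
by move=> nu0; move: dnu; rewrite nu0 rnorm0 leNgt d0.
Qed.

Lemma support_point_value_eq0 nu w e : support_point theta nu w ->
  value w e = 0 -> value nu (theta e) = 0.
Proof.
move=> sw ew; apply: contrapT => /eqP/carrier_gtP enu.
have [eps eps0 /(_ _ _ sw (lexx _))] := support_point_bound e enu.
by rewrite ew rnorm0 leNgt eps0.
Qed.

(** The lower bound confines the relevant support points to a compact set, so [e] can be cut off to
    compact support without changing its image at [nu]. *)
Lemma support_point_total nu : exists w, support_point theta nu w.
Proof.
have [e enu] := image_neq0 H nu; have /carrier_gtP r0 := enu.
set r := rnorm _ in r0.
have [eps eps0 He] := support_point_bound e (divr_gt0 r0 (ltr0n R 2)).
(* Zero below [eps / 4], one above [eps / 2]. *)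
pose h t : R := clamp (4 / eps * t - 1).
have h_continuous : continuous h.
  apply: clamp_continuous => s; apply: cvgB; last exact: cvg_cst.
  by apply: cvgM; [exact: cvg_cst|exact: cvg_id].
have h_eq0 t : t < eps / 4 -> h t = 0.
  move=> teps; apply: clamp0; rewrite subr_le0.
  have : 4 / eps * t <= 4 / eps * (eps / 4) by rewrite ler_pM2l ?ltW// divr_gt0.
  by have -> : 4 / eps * (eps / 4) = 1 by field; exact: (lt0r_neq0 eps0).
have h_eq1 t : eps / 2 < t -> h t = 1.
  move=> teps; apply: clamp1.
  have : 4 / eps * (eps / 2) <= 4 / eps * t by rewrite ler_pM2l ?ltW// divr_gt0.
  have -> : 4 / eps * (eps / 2) = 2 by field; exact: (lt0r_neq0 eps0).
  lra.
have [|a aE] := c0_of_rnorm e h_continuous; first by apply: h_eq0; lra.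
pose e' := ract e a.
(* Otherwise the images differ on a neighbourhood of [nu]. By density some $\nu'$ in it has a
   support point, and there $\|e\| \ge$ [eps], so the cutoff is 1 nearby. *)
have e'nu : value nu (theta e') = value nu (theta e).
  apply/esym/eqP; rewrite -subr_eq0 -valueB -raddfB; apply: contrapT => /negP dnu.
  have := @rnorm_value_gt_nbhs _ _ _ (theta e) nu (r / 2) ltac:(rewrite -/r; lra).
  move=> /(filterI (carrier_nbhs dnu))/(support_point_dense H).
  move=> [nu' [w' [[dnu' /ltW rnu'] sw']]]; move: dnu'.
  rewrite /carrier/= raddfB valueB (support_point_localize (a := a) sw') ?subrr ?eqxx//.
  have := @rnorm_value_gt_nbhs _ _ _ e w' (eps / 2).
  have := He _ _ sw' rnu' => ew' /(_ ltac:(lra)).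
  by apply: filterS => x xe; right; rewrite aE h_eq1.
have ce' : compact (supp e').
  have cK : compact [set w | eps / 4 <= rnorm (value w e)].
    by apply: rnorm_value_ge_compact; lra.
  have clK := compact_closed (hsl H) cK.
  apply: (subclosed_compact (@closed_closure _ _) cK); apply: supp_ract_sub clK _.
  by move=> w /negP; rewrite /= -ltNge => /h_eq0 hw; rewrite aE hw.
have [|w _ sw] := support_point_exists H ce' (nu := nu); first by rewrite e'nu.
by exists w.
Qed.

(* A section vanishing at one point and not at another cannot be compatible
   with the pointwise dependence of both maps. *)
Lemma support_point_inverse nu w nu' :
  (forall e, value w e = 0 -> value nu (theta e) = 0) ->
  (forall f, value nu' f = 0 -> value w (thetai f) = 0) -> nu = nu'.
Proof.
move=> sw sw'; apply: contrapT => nunu'.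
have nuU : nbhs nu (~` [set nu']).
  apply: open_nbhs_nbhs; split; last exact: nunu'.
  exact/closed_openC/accessible_closed_set1/hausdorff_accessible/(hsr H).
have [a [K [[_ _ KU] [_ /nbhs_singleton anu aK]]]] := point_bump (local_ortho_iso_sym H) nuU.
have [f /eqP fnu] := full_value_neq0 (lcr H) (hsr H) (fullr H) nu.
have : value nu (theta (thetai (ract f a))) = 0.
  by apply/sw/sw'; rewrite value_ract aK ?scale0r// => /KU; apply.
by rewrite (isoVK H) value_ract anu scale1r.
Qed.

End SupportPointMap.

(** * The scalar factor *)

Section ConformalFactor.
Context {R : realType} {X Y : topologicalType}.
Context {E : hilbertC0Module R X} {F : hilbertC0Module R Y}.
Context {theta : {linear E -> F}} {thetai : {linear F -> E}}.
Context (H : local_ortho_iso theta thetai).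
Context {nu : Y} {w : X} (sw : support_point theta nu w).

(* $x$ is orthogonal to $y\langle x,x\rangle - x\langle x,y\rangle$ everywhere. *)
Lemma image_inner_cross x y :
  inner (theta x) (theta y) nu * inner x x w
    = inner x y w * inner (theta x) (theta x) nu.
Proof.
pose z := ract y (inner x x) - ract x (inner x y).
have /(ortho H)/(congr1 (fun h : C0 R Y => h nu)) : inner x z = 0.
  apply: c0P => v; rewrite innerDr c0DE innerNr !inner_ractr.
  by rewrite mulrC subrr.
pose z' := inner x x w *: y - inner x y w *: x.
have zz' : value nu (theta z) = value nu (theta z').
  apply/eqP; rewrite -subr_eq0 -valueB -raddfB; apply/eqP.
  apply: (support_point_value_eq0 H sw).
  by rewrite !valueB !valueZ !value_ract subrr.
have -> : inner (theta x) (theta z) nu = inner (theta x) (theta z') nu.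
  apply/eqP; rewrite -subr_eq0 -innerNr -c0DE -innerDr.
  by rewrite inner_eq0r// valueB zz' subrr.
rewrite /z' raddfB/= !linearZ/= innerDr c0DE !innerZr !c0ZE innerNr mulrN.
by move=> /eqP; rewrite subr_eq0 => /eqP <-; rewrite mulrC.
Qed.

(** For non-orthogonal values, combine [image_inner_cross] with the conjugate of its version with
    arguments exchanged. For orthogonal ones, compare [x] with [x + y] and use Pythagoras in both
    fibres. *)
Lemma image_inner_ratio x y :
  inner (theta x) (theta x) nu * inner y y w
    = inner (theta y) (theta y) nu * inner x x w.
Proof.
have nonortho x' y' : inner x' y' w != 0 ->
    inner (theta x') (theta x') nu * inner y' y' w
      = inner (theta y') (theta y') nu * inner x' x' w.
  move=> xy0; apply: (mulfI xy0); rewrite !mulrA -image_inner_cross.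
  have := congr1 Num.conj (image_inner_cross y' x'); rewrite !rmorphM/= -!innerC => <-.
  by rewrite -!mulrA [_ * inner y' y' w]mulrC.
have [xy0|] := eqVneq (inner x y w) 0; last exact: nonortho.
have [xx0|xx0] := eqVneq (inner x x w) 0.
  have x0 : value w x = 0 by apply/eqP; rewrite value_eq0 xx0.
  by rewrite (inner_eq0l _ (support_point_value_eq0 H sw x0)) xx0 mul0r mulr0.
have txy0 : inner (theta x) (theta y) nu = 0.
  by apply: (mulIf xx0); rewrite image_inner_cross xy0 !mul0r.
have := nonortho x (x + y).
rewrite innerDr c0DE xy0 addr0 => /(_ xx0).
by rewrite raddfD/= !inner_sqrD// mulrDr mulrDl => /addrI.
Qed.

Lemma image_inner : exists2 psi : R, 0 < psi &
  forall x y, inner (theta x) (theta y) nu = (psi ^+ 2)%:C%C * inner x y w.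
Proof.
have [x0 x0nu] := image_neq0 H nu.
have x0w : value w x0 != 0.
  by apply: contra_neq x0nu => x0w; exact: support_point_value_eq0 H _ _ _ sw x0w.
exists (rnorm (value nu (theta x0)) / rnorm (value w x0)).
  by rewrite divr_gt0//; exact/carrier_gtP.
move=> x y; have [xx0|xx0] := eqVneq (inner x x w) 0.
  have xw : value w x = 0 by apply/eqP; rewrite value_eq0 xx0.
  have xnu := support_point_value_eq0 H sw xw.
  by rewrite (inner_eq0l _ xw) (inner_eq0l _ xnu) mulr0.
apply: (mulIf xx0); rewrite image_inner_cross.
rewrite expr_div_n rmorphM/= fmorphV -inner_value.
rewrite -[_ (rnorm (value w x0) ^+ 2)]/((rnorm (value w x0) ^+ 2)%:C%C) -inner_value.
have x0w' : inner x0 x0 w != 0 by rewrite -value_eq0.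
apply: (mulIf x0w').
rewrite -[LHS]mulrA image_inner_ratio.
by field.
Qed.

End ConformalFactor.

(** * Uniform boundedness of weighted point evaluations *)

Section UniformBound.
Context {R : realType} {X : topologicalType} {E : hilbertC0Module R X}.

(** Normalize a section at [w] and cut it off to the neighbourhood where its norm is below 2. *)
Lemma unit_value : locally_compact [set: X] -> hausdorff_space X ->
  full_module E -> forall w, exists2 x : E, rnorm (value w x) = 1 & rnorm x <= 2.
Proof.
move=> lcX hX fullE w; have [x0 x0w] := full_value_neq0 lcX hX fullE w.
have r0 : 0 < rnorm (value w x0) by exact/carrier_gtP.
pose x1 := ((rnorm (value w x0))^-1)%:C%C *: x0.
have x1w : rnorm (value w x1) = 1.
  by rewrite valueZ rnormZ gtr0_norm ?invr_gt0// mulVf ?gt_eqF.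
have U : nbhs w [set v | rnorm (value v x1) < 2].
  by apply: rnorm_value_lt_nbhs; rewrite x1w ltr1n.
have [a [K [[_ _ KU] [a1 /nbhs_singleton aw aK]]]] :=
  @locally_compact_bump R X w _ lcX hX U.
exists (ract x1 a); first by rewrite value_ract aw scale1r.
apply: rnorm_module_le => // v; rewrite value_ract.
have [/KU/= /ltW x1v|/aK ->] := pselect (K v); last by rewrite scale0r rnorm0.
by rewrite rnorm_le normrZ -[leRHS]mul1r ler_pM// -rnorm_le.
Qed.

Lemma rnorm_choose_sign (V : normedModType R[i]) (s v : V) (r : R) :
  r <= rnorm v -> r <= rnorm (s + v) \/ r <= rnorm (s - v).
Proof.
move=> rv; have [|sv] := leP r (rnorm (s + v)); first by left.
right; rewrite leNgt; apply/negP => sv'.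
have := rnormD (s + v) (- (s - v)).
have -> : s + v - (s - v) = (2 : R)%:C%C *: v.
  by rewrite opprB addrC addrA subrK -mulr2n -scaler_nat rmorph_nat.
by rewrite rnormN rnormZ ger0_norm//; lra.
Qed.

(* Uniform boundedness, by Sokal's choice of signs: each new term
   $\pm 8^{-n}x_n$ is signed so that the partial sum stays large at $w_n$. *)
Lemma value_uniform_bound (I : Type) (w : I -> X) (c : I -> R) :
  locally_compact [set: X] -> hausdorff_space X -> full_module E ->
  (forall x : E, exists M, forall i, c i * rnorm (value (w i) x) <= M) ->
  exists M, forall i, c i <= M.
Proof.
move=> lcX hX fullE pwb; apply: contrapT => /forallNP ub.
(* Growth $16^n$ beats the decay $8^{-n}$ of the terms by a factor $2^n$. *)
have /choice[i ci] : forall n, exists i, 16 ^+ n < c i.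
  by move=> n; have /existsNP[i /negP] := ub (16 ^+ n); rewrite -ltNge; exists i.
have /choice[x xP] : forall n, exists x : E,
    rnorm (value (w (i n)) x) = 1 /\ rnorm x <= 2.
  by move=> n; have [x] := unit_value lcX hX fullE (w (i n)); exists x.
pose q n : R := 8^-1 ^+ n.
have q0 n : 0 < q n by rewrite exprn_gt0// invr_gt0.
pose v n := (q n)%:C%C *: x n.
pose s n (S : E) := if q n <= rnorm (value (w (i n)) (S + v n)) then v n else - v n.
have sq n S : q n <= rnorm (value (w (i n)) (S + s n S)).
  rewrite /s; case: ifPn => //; rewrite -ltNge => lt_q.
  have vq : q n <= rnorm (value (w (i n)) (v n)).
    by rewrite valueZ rnormZ (xP n).1 mulr1 gtr0_norm.
  have := rnorm_choose_sign (value (w (i n)) S) vq.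
  by rewrite -valueD -valueB leNgt lt_q => -[].
pose fix S n : E := if n is m.+1 then S m + s m (S m) else 0.
pose u n := s n (S n).
have SE n : S n = \sum_(j < n) u j.
  by elim: n => [|n IH]; rewrite ?big_ord0// big_ord_recr/= -IH.
have uM n : rnorm (u n) <= 2 * 8^-1 ^+ n.
  have vM : rnorm (v n) <= 2 * 8^-1 ^+ n.
    by rewrite rnormZ gtr0_norm// mulrC ler_pM2r// (xP n).2.
  by rewrite /u /s; case: ifP => _; rewrite ?rnormN.
have [k kE] := sum_geometric (r := 8^-1) ltac:(lra) uM.
(* The tail after [n.+1] terms is at most $\frac{2}{7} 8^{-n}$, leaving $\frac{5}{7} 8^{-n}$. *)
have kq n : q n / 2 <= rnorm (value (w (i n)) k).
  have kS : rnorm (value (w (i n)) (S n.+1 - k)) <= q n * (2 / 7).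
    apply: le_trans (rnorm_value_le _ _) _; rewrite SE -rnormN opprB; apply: le_trans (kE _) _.
    rewrite exprSr -/(q n) le_eqVlt; apply/orP; left; apply/eqP.
    by field.
  have Sq : q n <= rnorm (value (w (i n)) (S n.+1)) := sq n (S n).
  have := rnormB (value (w (i n)) (S n.+1)) (value (w (i n)) k).
  by rewrite -valueB; have := q0 n; lra.
have [M kM] := pwb k.
have half : 0 < (2^-1 : R) < 1 by lra.
have [m mM] := @geometric_small R (2 * M) _ _ half ltr01.
move: mM. 
apply/negP; rewrite -leNgt exprVn ler_pdivlMr ?exprn_gt0// mul1r.
have := kM (i m); rewrite -(ler_pM2l (ltr0n R 2)); apply: le_trans.
have c0 : 0 < c (i m) by apply: lt_trans (ci m); rewrite exprn_gt0.
apply: (@le_trans _ _ (16 ^+ m * q m)).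
  by rewrite /q -exprMn; have -> : 16 / 8 = 2 :> R by field.
rewrite mulrCA ler_pM ?exprn_ge0 ?invr_ge0 ?(ltW (ci m))//.
by have := kq m; lra.
Qed.

End UniformBound.

(** * The representation *)

Section Representation.
Context {R : realType} {X Y : topologicalType}.
Context {E : hilbertC0Module R X} {F : hilbertC0Module R Y}.
Context {theta : {linear E -> F}} {thetai : {linear F -> E}}.
Context (H : local_ortho_iso theta thetai).

(** Support points of the map and of its inverse are chosen independently; [support_point_inverse]
    makes the two choices mutually inverse. *)
Lemma representation : exists (sigma : Y -> X) (psi : Y -> R),
  [/\ homeomorphism sigma, forall nu, 0 < psi nu &
      forall nu x y, inner (theta x) (theta y) nu
        = (psi nu ^+ 2)%:C%C * inner x y (sigma nu)].
Proof.
have /choice[sigma ssigma] := support_point_total H.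
have H' := local_ortho_iso_sym H.
have /choice[tau stau] := support_point_total H'.
have /choice[psi psiP] : forall nu, exists c : R, 0 < c /\
    forall x y, inner (theta x) (theta y) nu = (c ^+ 2)%:C%C * inner x y (sigma nu).
  by move=> nu; have [c] := image_inner H (ssigma nu); exists c.
exists sigma, psi; split=> [|nu|nu]; [|exact: (psiP nu).1|exact: (psiP nu).2].
exists tau; split.
- move=> nu; apply/esym/(support_point_inverse H (w := sigma nu)) => g.
    exact: (support_point_value_eq0 H).
  exact: (support_point_value_eq0 H').
- move=> w; apply/esym/(support_point_inverse H' (w := tau w)) => g.
    exact: (support_point_value_eq0 H').
  exact: (support_point_value_eq0 H).
- move=> nu U nuU; have := support_point_continuous H (ssigma nu) nuU.
  by apply: filterS => nu'; apply.
- move=> w U wU; have := support_point_continuous H' (stau w) wU.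
  by apply: filterS => w'; apply.
Qed.

Context {sigma : Y -> X} {psi : Y -> R}.
Context (csigma : continuous sigma) (psi0 : forall nu, 0 < psi nu).
Context (psiE : forall nu x y, inner (theta x) (theta y) nu
  = (psi nu ^+ 2)%:C%C * inner x y (sigma nu)).

Lemma rnorm_image nu x :
  rnorm (value nu (theta x)) = psi nu * rnorm (value (sigma nu) x).
Proof.
have := psiE nu x x; rewrite !inner_value -rmorphM -exprMn => /complexI/eqP.
by rewrite eqrXn2 ?rnorm_ge0 ?mulr_ge0 ?rnorm_ge0 ?(ltW (psi0 nu))// => /eqP.
Qed.

(** Near [nu], [psi] is a quotient of two continuous fibre norms, taken for a section nonzero at
    [sigma nu]. *)
Lemma factor_continuous : continuous psi.
Proof.
move=> nu; have [x xnu] := full_value_neq0 (lcl H) (hsl H) (fulll H) (sigma nu).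
have cx : {for nu, continuous (fun v => rnorm (value (sigma v) x))}.
  apply: (@continuous_comp _ _ _ sigma (fun v => rnorm (value v x))).
    exact: csigma.
  exact: rnorm_value_continuous.
have quot : {for nu, continuous (fun v =>
    rnorm (value v (theta x)) / rnorm (value (sigma v) x))}.
  apply: cvgM; first exact: rnorm_value_continuous.
  by apply: cvgV => //; rewrite rnorm_eq0.
rewrite /continuous_at [X in _ --> X](_ : _ =
    rnorm (value nu (theta x)) / rnorm (value (sigma nu) x)).
  apply: cvg_trans quot; apply: near_eq_cvg.
  have xv : \forall v \near nu, value (sigma v) x != 0.
    exact: (csigma (carrier_nbhs xnu)).
  near=> v => /=.
  by rewrite rnorm_image mulfK// rnorm_eq0; near: v.
by rewrite rnorm_image mulfK// rnorm_eq0.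
Unshelve. all: by end_near. Qed.

(** For fixed [x] the quantities $\psi(\nu)\|x(\sigma(\nu))\|$ are bounded by $\|\theta(x)\|$, so
    uniform boundedness applies although [theta] is not yet known to be bounded. *)
Lemma factor_bounded : exists M, forall nu, psi nu <= M.
Proof.
apply: (value_uniform_bound (w := sigma) (lcl H) (hsl H) (fulll H)) => x.
by exists (rnorm (theta x)) => nu; rewrite -rnorm_image rnorm_value_le.
Qed.

Lemma value_image_eq0 nu e :
  (value nu (theta e) == 0) = (value (sigma nu) e == 0).
Proof. by rewrite -!rnorm_eq0 rnorm_image mulf_eq0 gt_eqF. Qed.

(** Defined on chosen representatives; [fibre_mapE] shows independence of the choice. *)
Definition fibre_map nu (u : fibre E (sigma nu)) : fibre F nu :=
  ((psi nu)^-1)%:C%C *: value nu (theta (repr u)).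

Lemma fibre_mapE nu e :
  fibre_map (value (sigma nu) e) = ((psi nu)^-1)%:C%C *: value nu (theta e).
Proof.
congr (_ *: _); apply/eqP; rewrite -subr_eq0 -valueB -raddfB value_image_eq0.
rewrite valueB subr_eq0 eq_sym; apply/eqP/value_eq.
exact: null_repr.
Qed.

Lemma fibre_map_unitary nu : unitary (@fibre_map nu).
Proof.
have cV : (psi nu)%:C%C * ((psi nu)^-1)%:C%C = 1.
  by rewrite -rmorphM/= mulfV ?gt_eqF.
split.
- move=> c; elim/value_ind => x; elim/value_ind => y.
  rewrite -valueZ -valueD !fibre_mapE linearP valueD valueZ scalerDr.
  by rewrite scalerA mulrC -scalerA.
- elim/value_ind => f; exists (value (sigma nu) ((psi nu)%:C%C *: thetai f)).
  by rewrite fibre_mapE linearZ valueZ scalerA mulrC cV scale1r (isoVK H).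
- elim/value_ind => x; elim/value_ind => y.
  rewrite !fibre_mapE -!valueZ -!linearZ !fibre_innerE psiE innerZr c0ZE innerZl.
  rewrite conj_Creal ?complex_real//.
  have -> : (psi nu ^+ 2)%:C%C = (psi nu)%:C%C * (psi nu)%:C%C.
    by rewrite expr2 rmorphM.
  by rewrite -mulrA [X in _ * X]mulrA cV mul1r mulrA cV mul1r.
Qed.

Lemma fibre_map_continuous e :
  continuous_section (fun nu => fibre_map (value (sigma nu) e)).
Proof.
(* Freezing the scalar at [nu0] leaves the error
   $|\psi(\nu)^{-1}-\psi(\nu_0)^{-1}|\,\|\theta(e)(\nu)\|$. *)
move=> nu0 eps eps0; exists (((psi nu0)^-1)%:C%C *: theta e).
have eps0' : 0 < complex.Re eps by rewrite -ltcR -normcE// ltW.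
have d0 : 0 < complex.Re eps / (rnorm (theta e) + 1).
  by rewrite divr_gt0// ltr_wpDl// rnorm_ge0.
have /cvgrPdist_lt/(_ _ d0) : (fun nu => (psi nu)^-1) @ nu0 --> (psi nu0)^-1.
  by apply: cvgV; [exact: lt0r_neq0|exact: factor_continuous].
apply: filterS => nu psi_nu; rewrite fibre_mapE valueZ -scalerBl -rmorphB.
rewrite rnormE [eps]normcE ?ltW// ltcR rnormZ distrC.
move: psi_nu; rewrite ltr_pdivlMr ?ltr_wpDl ?rnorm_ge0//.
apply: le_lt_trans; rewrite ler_wpM2l//.
by rewrite (le_trans (rnorm_value_le _ _))// lerDl.
Qed.

Lemma image_bounded : bounded_operator theta.
Proof.
(* Over an empty space [M] may be negative. *)
have [M psiM] := factor_bounded; exists (Num.max M 0) => e.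
have M0 : 0 <= Num.max M 0 by rewrite le_max lexx orbT.
rewrite !rnormE -rmorphM lecR; apply: rnorm_module_le => [|nu].
  by rewrite mulr_ge0// rnorm_ge0.
rewrite rnorm_image ler_pM ?rnorm_ge0 ?(ltW (psi0 nu)) ?rnorm_value_le//.
by rewrite le_max psiM.
Qed.

End Representation.

Theorem theorem3p12 (R : realType) (Omega Delta : topologicalType)
  (lcOmega : locally_compact [set: Omega]) (hOmega : hausdorff_space Omega)
  (lcDelta : locally_compact [set: Delta]) (hDelta : hausdorff_space Delta)
  (E : hilbertC0Module R Omega) (F : hilbertC0Module R Delta)
  (fullE : full_module E) (fullF : full_module F)
  (theta : {linear E -> F}) (thetai : F -> E)
  (thetaK : cancel theta thetai) (thetaiK : cancel thetai theta)
  (ql : quasi_local theta) (qli : quasi_local thetai)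
  (op : orthogonality_preserving theta)
  (opi : orthogonality_preserving thetai) :
  bounded_operator theta /\
  exists (sigma : Delta -> Omega) (psi : Delta -> R)
         (J : forall nu : Delta, fibre E (sigma nu) -> fibre F nu),
    [/\ homeomorphism sigma,
        Cb_nonneg psi /\ (forall nu, 0 < psi nu),
        (forall nu, unitary (J nu)),
        (forall f : E,
           continuous_section (fun nu => J nu (value (sigma nu) f))) &
        forall (e : E) (nu : Delta),
          value nu (theta e) =
            (psi nu)%:C%C *: J nu (value (sigma nu) e)].
Proof.
have [linV [thetaV [thetaVK thetaKV loc']]] := qli.
have [_ [thetai' [thetaK' thetaiK' loc]]] := ql.
(* Quasi-locality only asserts that some inverse exists; uniqueness identifies it with the given
   one. *)
have thetai'E : thetai' = thetai.
  by apply/funext => f; rewrite -{1}[f]thetaiK thetaK'.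
have thetaVE : thetaV = theta.
  by apply/funext => e; rewrite -{1}[e]thetaK thetaVK.
rewrite {}thetai'E {}thetaVE in loc loc'.
pose L : {linear F -> E} := HB.pack thetai (GRing.isLinear.Build _ _ _ _ thetai linV).
have H : local_ortho_iso theta L by split.
have [sigma [psi [hsigma psi0 psiE]]] := representation H.
have csigma : continuous sigma by have [? []] := hsigma.
split; first exact: (image_bounded H psi0 psiE).
exists sigma, psi, (fun nu => @fibre_map _ _ _ _ _ theta sigma psi nu).
split=> //.
- split=> //; split; [exact: (factor_continuous H csigma psi0 psiE)| |by move=> nu; exact: ltW].
  have [M psiM] := factor_bounded H psi0 psiE.
  exists M; split; first exact: num_real.
  by move=> r Mr nu _ /=; rewrite gtr0_norm// (le_trans (psiM nu))// ltW.
- by move=> nu; exact: (fibre_map_unitary H psi0 psiE nu).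
- by move=> f; exact: (fibre_map_continuous H csigma psi0 psiE f).
- move=> e nu; rewrite (fibre_mapE psi0 psiE) scalerA -rmorphM/= mulfV ?gt_eqF//.
  by rewrite scale1r.
Qed.
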